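(* Let $G$ be a finite group and $H$ a normal subgroup of $G$. The enhanced quotient graph $\mathcal{G}_H(G)$ is complete if and only if $G/H$ is cyclic.
   Context: For a finite group $G$ with a normal subgroup $H$, the enhanced quotient graph $\mathcal{G}_H(G)$ is the simple graph with vertex set $(G\setminus H)\cup\{e\}$, where $e$ is the identity of $G$, in which two distinct vertices $x,y$ are adjacent if $xH=yH$ or $xH,yH\in\langle zH\rangle$ for some $z\in G$. *)

(* Defs.v *)
From HB Require Import structures.
From mathcomp Require Import all_boot all_fingroup all_solvable.

Set Implicit Arguments.
Unset Strict Implicit.
Unset Printing Implicit Defensive.

Local Open Scope group_scope.

(* Simple graphs whose vertex set is a subset of a finite type. *)
Record sgraph (T : finType) := SGraph {
  vertices : {set T};
  adj : rel T;
  adj_vertices : forall x y, adj x y -> (x \in vertices) && (y \in vertices);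
  adj_sym : symmetric adj;
  adj_irrefl : irreflexive adj
}.

Definition complete_graph (T : finType) (g : sgraph T) : Prop :=
  {in vertices g &, forall x y, x != y -> adj g x y}.

Section EnhancedQuotientGraph.

Variables (gT : finGroupType) (G H : {group gT}).

Definition eqg_vertices : {set gT} := (G :\: H) :|: [set 1].

(* coset H x is the coset xH only for x in 'N(H) (elsewhere it is the trivial
   coset); this holds for all x, y, z below when H <| G. *)
Definition eqg_adj : rel gT := fun x y =>
  [&& x \in eqg_vertices, y \in eqg_vertices, x != y &
      (coset H x == coset H y)
      || [exists z in G, (coset H x \in <[coset H z]>)
                         && (coset H y \in <[coset H z]>)]].

Lemma eqg_adj_vertices x y :
  eqg_adj x y -> (x \in eqg_vertices) && (y \in eqg_vertices).
Proof. by case/and4P=> -> ->. Qed.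

Lemma eqg_adj_sym : symmetric eqg_adj.
Proof.
move=> x y; rewrite /eqg_adj andbCA (eq_sym x) (eq_sym (coset H x)).
by under eq_existsb do rewrite [X in _ && X]andbC.
Qed.

Lemma eqg_adj_irrefl : irreflexive eqg_adj.
Proof. by move=> x; rewrite /eqg_adj eqxx /= !andbF. Qed.

Definition enhanced_quotient_graph : sgraph gT :=
  SGraph eqg_adj_vertices eqg_adj_sym eqg_adj_irrefl.

End EnhancedQuotientGraph.

(* Main.v *)
Require Import Defs.
From mathcomp Require Import all_boot all_fingroup all_solvable.

Local Open Scope group_scope.

(** Distinct vertices are adjacent exactly when their cosets lie in a common cyclic subgroup of
    [G / H] (equal cosets trivially do). So completeness says that any two elements of [G / H] share
    a cyclic subgroup, and [cyclic_pairwise] applies: if [x] has maximal order, a cyclic subgroup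
    containing [x] and [y] is already [<[x]>]. Conversely, a generator of [G / H] serves every
    pair. *)

(* An element of maximal order generates. *)
Lemma cyclic_pairwise (gT : finGroupType) (G : {group gT}) :
    {in G &, forall x y,
      exists2 z, z \in G & (x \in <[z]>) && (y \in <[z]>)} ->
  cyclic G.
Proof.
move=> pairG.
have [x Gx max_x]: exists2 x, x \in G & forall y, y \in G -> #[y] <= #[x].
  by case: (arg_maxnP (fun x => #[x]) (group1 G)) => x; exists x.
apply/cyclicP; exists x; apply/eqP; rewrite eqEsubset cycle_subG Gx andbT.
apply/subsetP=> y Gy.
have [z Gz /andP[xz yz]] := pairG x y Gx Gy.
have /eqP-> // : <[x]> == <[z]>.
by rewrite eqEcard cycle_subG xz; apply: max_x.
Qed.

Theorem theorem3p1 (gT : finGroupType) (G H : {group gT}) (nsHG : H <| G) :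
  complete_graph (enhanced_quotient_graph G H) <-> cyclic (G / H).
Proof.
split=> [complG | /cyclicP[zb defGH] x y Vx Vy neq_xy].
  apply: cyclic_pairwise => _ _ /morphimP[x _ Gx ->] /morphimP[y _ Gy ->] /=.
  have GHx := mem_quotient H Gx; have GHy := mem_quotient H Gy.
  (* Nontrivial elements of [H] are not vertices, so [complG] says nothing about them; but their
     coset is trivial and lies in every cyclic subgroup. *)
  have [Hx | H'x] := boolP (x \in H).
    by exists (coset H y) => //; rewrite (coset_id Hx) group1 cycle_id.
  have [Hy | H'y] := boolP (y \in H).
    by exists (coset H x) => //; rewrite (coset_id Hy) group1 cycle_id.
  have [<- | neq_xy] := eqVneq x y.
    by exists (coset H x) => //; rewrite cycle_id.
  have /and4P[_ _ _] : eqg_adj G H x y.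
    by apply: complG => //; rewrite !inE ?H'x ?H'y ?Gx ?Gy.
  case/orP=> [/eqP <- | /exists_inP[z Gz xyz]].
    by exists (coset H x) => //; rewrite cycle_id.
  by exists (coset H z); rewrite // mem_quotient.
have sVG u : u \in eqg_vertices G H -> u \in G.
  by rewrite !inE => /orP[/andP[] | /eqP->].
(* Adjacency asks for a witness in [G], so the generator [zb] is lifted to [z]. *)
have /morphimP[z _ Gz def_zb] : zb \in G / H by rewrite defGH cycle_id.
apply/and4P; split=> //; apply/orP; right; apply/exists_inP; exists z => //.
by rewrite -def_zb -defGH !mem_quotient ?sVG.
Qed.
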